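(* Let $\mathbb{C}$ be a category with finite limits, let $H:\mathbb{M}\to\mathbb{C}$ be the inclusion of a full reflective subcategory, with reflector (left adjoint) $I:\mathbb{C}\to\mathbb{M}$ and unit $\eta:1_{\mathbb{C}}\to HI$. Let $U:\mathbb{C}\to\mathbf{Set}$ be a functor such that: (a) $U$ preserves finite limits; (b) $UH$ reflects isomorphisms; (c) $U(\eta_C):U(C)\to UHI(C)$ is surjective for every object $C\in\mathbb{C}$; (d) for every object $M\in\mathbb{M}$ and $T$ a terminal object of $\mathbb{C}$, the map $\mathbb{C}(T,M)\to\mathbf{Set}(U(T),U(M))$, $f\mapsto U(f)$, is surjective. Then the reflection $I\dashv H$ has stable units if and only if $HI(C_\mu\times D_\nu)\cong T$ for all objects $C,D\in\mathbb{C}$ and all morphisms $\mu:T\to HI(C)$ and $\nu:T\to HI(D)$ from a terminal object $T$ of $\mathbb{C}$, where $C_\mu$ and $D_\nu$ are the connected components of $\mu$ and $\nu$.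
   Context: Connected component: for $C\in\mathbb{C}$ and a morphism $\mu:T\to HI(C)$ with $T$ terminal in $\mathbb{C}$, the connected component of $\mu$ is the pullback $C_\mu=C\times_{HI(C)}T$ of $\mu$ along the unit morphism $\eta_C:C\to HI(C)$. Stable units: the reflection $I\dashv H$ has stable units if $I$ preserves all pullback squares obtained by pulling back an arbitrary morphism $g:D\to HI(C)$ of $\mathbb{C}$ along a unit morphism $\eta_C:C\to HI(C)$, for all $C,D\in\mathbb{C}$. Conventions: objects of $\mathbb{M}$ are regarded as objects of $\mathbb{C}$ via $H$. Without loss of generality, the unit is chosen so that the counit is an identity, $IH=1_{\mathbb{M}}$, and the terminal object $T$ of $\mathbb{C}$ is chosen in $\mathbb{M}$. *)

(* Defs.v *)
From Stdlib Require Import FinFun.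
Set Implicit Arguments.
Unset Strict Implicit.
Unset Printing Implicit Defensive.

Reserved Notation "g ∘ f" (at level 40, left associativity).

Record Category := {
  ob :> Type;
  hom : ob -> ob -> Type;
  idm : forall x, hom x x;
  comp : forall x y z, hom y z -> hom x y -> hom x z;
  comp_id_l : forall x y (f : hom x y), comp (idm y) f = f;
  comp_id_r : forall x y (f : hom x y), comp f (idm x) = f;
  comp_assoc : forall w x y z (h : hom y z) (g : hom x y) (f : hom w x),
    comp h (comp g f) = comp (comp h g) f
}.
Arguments hom {c} _ _.
Arguments idm {c} _.
Arguments comp {c x y z} _ _.
Notation "g ∘ f" := (comp g f).

Record Functor (A B : Category) := {
  fob :> A -> B;
  fmap : forall x y : A, hom x y -> hom (fob x) (fob y);
  fmap_id : forall x : A, fmap (idm x) = idm (fob x);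
  fmap_comp : forall (x y z : A) (g : hom y z) (f : hom x y),
    fmap (g ∘ f) = fmap g ∘ fmap f
}.
Arguments fmap {A B} _ {x y} _.

Definition idF (A : Category) : Functor A A.
Proof.
  refine {| fob := fun x : A => x; fmap := fun _ _ f => f |}; reflexivity.
Defined.

Definition compF (A B C : Category) (G : Functor B C) (F : Functor A B) :
  Functor A C.
Proof.
  refine {| fob := fun x => G (F x); fmap := fun _ _ f => fmap G (fmap F f) |}.
  - abstract (intros x; rewrite !fmap_id; reflexivity).
  - abstract (intros x y z g f; rewrite !fmap_comp; reflexivity).
Defined.

Record NatTrans (A B : Category) (F G : Functor A B) := {
  component :> forall x : A, hom (F x) (G x);
  naturality : forall (x y : A) (f : hom x y),
    component y ∘ fmap F f = fmap G f ∘ component x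
}.

Record Adjunction (A B : Category) (L : Functor A B) (R : Functor B A) := {
  adj_unit : NatTrans (idF A) (compF R L);
  adj_counit : NatTrans (compF L R) (idF B);
  triangle_l : forall x : A, adj_counit (L x) ∘ fmap L (adj_unit x) = idm (L x);
  triangle_r : forall y : B, fmap R (adj_counit y) ∘ adj_unit (R y) = idm (R y)
}.

(* A full subcategory is determined by the predicate singling out its objects. *)
Definition FullSubcategory (C : Category) (inM : C -> Prop) : Category.
Proof.
  refine {| ob := {x : C | inM x};
            hom := fun x y => hom (proj1_sig x) (proj1_sig y);
            idm := fun x => idm (proj1_sig x);
            comp := fun x y z g f => g ∘ f |}.
  - intros; apply comp_id_l.
  - intros; apply comp_id_r.
  - intros; apply comp_assoc.
Defined.

Definition inclusion (C : Category) (inM : C -> Prop) :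
  Functor (FullSubcategory inM) C.
Proof.
  refine (@Build_Functor (FullSubcategory inM) C
            (fun x => proj1_sig x) (fun _ _ f => f) _ _); reflexivity.
Defined.

Definition SetCat : Category.
Proof.
  refine {| ob := Type; hom := fun X Y => X -> Y;
            idm := fun X x => x;
            comp := fun X Y Z g f x => g (f x) |}; reflexivity.
Defined.

Definition IsIso (C : Category) (x y : C) (f : hom x y) : Prop :=
  exists g : hom y x, g ∘ f = idm x /\ f ∘ g = idm y.

Definition Isomorphic (C : Category) (x y : C) : Prop :=
  exists f : hom x y, IsIso f.

Definition ReflectsIsos (A B : Category) (F : Functor A B) : Prop :=
  forall (x y : A) (f : hom x y), IsIso (fmap F f) -> IsIso f.

Definition IsFiniteCategory (J : Category) : Prop :=
  Finite J /\ forall x y : J, Finite (hom x y).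

Record Cone (J C : Category) (F : Functor J C) := {
  apex : C;
  leg : forall j : J, hom apex (F j);
  leg_natural : forall (i j : J) (a : hom i j), fmap F a ∘ leg i = leg j
}.
Arguments leg {J C F} _ _.

Definition IsLimit (J C : Category) (F : Functor J C) (c : Cone F) : Prop :=
  forall d : Cone F,
  exists! u : hom (apex d) (apex c), forall j : J, leg c j ∘ u = leg d j.

Definition mapCone (J A B : Category) (G : Functor A B) (F : Functor J A)
  (c : Cone F) : Cone (compF G F).
Proof.
  refine (@Build_Cone J B (compF G F) (G (apex c))
            (fun j => fmap G (leg c j)) _).
  abstract (intros i j a; simpl;
            rewrite <- fmap_comp, leg_natural; reflexivity).
Defined.

Definition HasFiniteLimits (C : Category) : Prop :=
  forall (J : Category) (F : Functor J C),
  IsFiniteCategory J -> exists c : Cone F, IsLimit c.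

Definition PreservesFiniteLimits (A B : Category) (G : Functor A B) : Prop :=
  forall (J : Category) (F : Functor J A),
  IsFiniteCategory J ->
  forall c : Cone F, IsLimit c -> IsLimit (mapCone G c).

Definition IsTerminal (C : Category) (T : C) : Prop :=
  forall x : C, exists! f : hom x T, True.

Definition IsProduct (C : Category) (x y p : C)
  (p1 : hom p x) (p2 : hom p y) : Prop :=
  forall (z : C) (a : hom z x) (b : hom z y),
  exists! u : hom z p, p1 ∘ u = a /\ p2 ∘ u = b.

Definition IsPullback (C : Category) (x y z p : C)
  (f : hom x z) (g : hom y z) (p1 : hom p x) (p2 : hom p y) : Prop :=
  f ∘ p1 = g ∘ p2 /\
  forall (w : C) (a : hom w x) (b : hom w y), f ∘ a = g ∘ b ->
  exists! u : hom w p, p1 ∘ u = a /\ p2 ∘ u = b.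

Definition HasStableUnits (C M : Category) (I : Functor C M) (H : Functor M C)
  (adj : Adjunction I H) : Prop :=
  forall (X Y : C) (g : hom Y (H (I X)))
         (P : C) (p1 : hom P X) (p2 : hom P Y),
  IsPullback (adj_unit adj X) g p1 p2 ->
  IsPullback (fmap I (adj_unit adj X)) (fmap I g) (fmap I p1) (fmap I p2).

(* A pullback is only determined up to isomorphism, so this is the type of
   all connected components of [mu]; it is used with [T] terminal. *)
Record ConnectedComponent (C M : Category) (I : Functor C M) (H : Functor M C)
  (adj : Adjunction I H) (T X : C) (mu : hom T (H (I X))) := {
  cc_ob :> C;
  cc_incl : hom cc_ob X;
  cc_term : hom cc_ob T;
  cc_pullback : IsPullback (adj_unit adj X) mu cc_incl cc_term
}.

(* Main.v *)
Require Import Defs.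
From Stdlib Require Import FinFun.
From Stdlib Require Import List FunctionalExtensionality IndefiniteDescription.
Import ListNotations.
Set Implicit Arguments.
Unset Strict Implicit.
Unset Printing Implicit Defensive.

(** Write [η] for the unit and [HI] for the reflector viewed as an endofunctor
    of [C].  Since [I] inverts every unit, a commutative square in [M] having
    [I η] as one side is a pullback exactly when the opposite side is
    invertible.  Stable units therefore say: whenever [p2 : P -> Y] is the
    pullback of some [η_X] along some [g : Y -> HI X], the morphism [HI p2] is
    invertible ([stable_units_iff_iso]).

    Stable units imply the product condition formally.  A connected component
    [X_mu] is a pullback of a unit along a morphism from [T], so
    [HI X_mu] is isomorphic to [HI T], which is terminal.  Hence the product
    [X_mu * Y_nu] is also the pullback of [η] at [X_mu] along the morphism from
    [Y_nu] to the terminal object [HI X_mu], and [HI] sends its projection to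
    [Y_nu] to an isomorphism onto a terminal object.

    For the converse, [UH] reflects isomorphisms, so it is enough that
    [U (HI p2)] is bijective.  Surjectivity holds because [U p2] is a pullback
    of the surjection [U η_X] and [U η_Y] is surjective.  For injectivity, let
    [a] and [b] in [U (HI P)] have the same image [c] in [U (HI Y)].  The
    element [c] comes from a morphism [nu : T -> HI Y]; composing it with the
    extension [HI Y -> HI X] of [g] gives [mu : T -> HI X].  The components of
    [mu] and [nu] map compatibly to [X] and [Y], hence there is
    [h : X_mu * Y_nu -> P].  Because [U] preserves pullbacks, every element of
    [U P] lying over [c] is in the image of [U h]; as [U η_P] is surjective,
    both [a] and [b] lie in the image of [U (HI h)].  Its domain is
    [U (HI (X_mu * Y_nu))], a singleton by the product condition, so [a = b]. *)

(** * Isomorphisms, terminal objects and pullbacks *)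

Lemma terminal_unique (C : Category) (T : C) (hT : IsTerminal T) (x : C)
  (f g : hom x T) : f = g.
Proof.
  destruct (hT x) as [u [_ hu]].
  rewrite <- (hu f Logic.I); apply hu; exact Logic.I.
Qed.

Lemma terminal_of_iso (C : Category) (x T : C) (f : hom x T) :
  IsIso f -> IsTerminal T -> IsTerminal x.
Proof.
  intros [g [hgf hfg]] hT y; destruct (hT y) as [u _].
  exists (g ∘ u); split; [exact Logic.I|]; intros v _.
  rewrite (terminal_unique hT u (f ∘ v)), comp_assoc, hgf; apply comp_id_l.
Qed.

Lemma terminal_isomorphic (C : Category) (S T : C) :
  IsTerminal S -> IsTerminal T -> Isomorphic S T.
Proof.
  intros hS hT; destruct (hT S) as [f _], (hS T) as [g _].
  exists f, g; split; apply terminal_unique; assumption.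
Qed.

Lemma product_iff_pullback (C : Category) (x y T p : C) (hT : IsTerminal T)
  (f : hom x T) (g : hom y T) (p1 : hom p x) (p2 : hom p y) :
  IsProduct p1 p2 <-> IsPullback f g p1 p2.
Proof.
  split.
  - intros hp; split; [apply (terminal_unique hT)|]; intros w a b _; apply hp.
  - intros [_ hp] w a b; apply hp, (terminal_unique hT).
Qed.

Lemma pullback_iff_iso (C : Category) (x y z p : C)
  (f : hom x z) (g : hom y z) (p1 : hom p x) (p2 : hom p y) :
  IsIso f -> f ∘ p1 = g ∘ p2 -> (IsPullback f g p1 p2 <-> IsIso p2).
Proof.
  intros [f' [hf'f hff']] sq; split.
  - intros [_ hp].
    destruct (hp y (f' ∘ g) (idm y)) as [s [[hs1 hs2] _]].
    { rewrite comp_assoc, hff', comp_id_l, comp_id_r; reflexivity. }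
    exists s; split; [|exact hs2].
    destruct (hp p p1 p2 sq) as [u [_ hu]].
    transitivity u; [symmetry|]; apply hu; split; try apply comp_id_r.
    + rewrite comp_assoc, hs1, <- comp_assoc, <- sq, comp_assoc, hf'f.
      apply comp_id_l.
    + rewrite comp_assoc, hs2; apply comp_id_l.
  - intros [s [hs1 hs2]]; split; [exact sq|]; intros w a b hab.
    exists (s ∘ b); split; [split|].
    + rewrite <- (comp_id_l (p1 ∘ (s ∘ b))), <- hf'f, <- comp_assoc.
      rewrite (comp_assoc f), sq, (comp_assoc (g ∘ p2)), <- (comp_assoc g).
      rewrite hs2, comp_id_r, <- hab, comp_assoc, hf'f; apply comp_id_l.
    + rewrite comp_assoc, hs2; apply comp_id_l.
    + intros v [_ hv]; rewrite <- hv, comp_assoc, hs1; apply comp_id_l.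
Qed.

(** * Terminal objects and pullbacks as finite limits *)

Definition EmptyCat : Category.
Proof.
  refine {| ob := Empty_set; hom := fun _ _ => Empty_set;
            idm := fun x => x; comp := fun _ _ _ g _ => g |};
    intros [].
Defined.

Definition emptyF (C : Category) : Functor EmptyCat C.
Proof.
  refine (@Build_Functor EmptyCat C (fun x : Empty_set => match x with end)
            (fun x => match x with end) _ _); intros [].
Defined.

Lemma EmptyCat_finite : IsFiniteCategory EmptyCat.
Proof. split; [exists []|]; intros []. Qed.

Lemma limit_iff_terminal (C : Category) (D : Functor EmptyCat C) (c : Cone D) :
  IsLimit c <-> IsTerminal (apex c).
Proof.
  split.
  - intros hl x.
    unshelve epose (d := @Build_Cone EmptyCat C D x
                           (fun j : Empty_set => match j with end) _).
    { intros []. }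
    destruct (hl d) as [u [_ hu]].
    exists u; split; [exact Logic.I|]; intros v _; apply hu; intros [].
  - intros ht d; destruct (ht (apex d)) as [u _].
    exists u; split; [intros []|]; intros v _; apply (terminal_unique ht).
Qed.

Inductive cospan_ob := Left | Right | Base.

(** The cospan is encoded as a preorder, so that its laws hold by cases on
    objects and no equality of dependent pairs arises. *)
Definition cospan_hom (i j : cospan_ob) : Type :=
  match i, j with
  | Left, Left | Right, Right | _, Base => unit
  | _, _ => Empty_set
  end.

Definition Cospan : Category.
Proof.
  unshelve refine {| ob := cospan_ob; hom := cospan_hom |}.
  - intros []; exact tt.
  - intros [] [] []; simpl; try (intros; exact tt); intros; assumption.
  - intros [] [] []; reflexivity.
  - intros [] [] []; reflexivity.
  - intros [] [] [] [] [] [] []; reflexivity.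
Defined.

Definition to_base_l : @hom Cospan Left Base := tt.
Definition to_base_r : @hom Cospan Right Base := tt.

Lemma Cospan_finite : IsFiniteCategory Cospan.
Proof.
  split; [exists [Left; Right; Base]; intros []; simpl; auto|].
  intros [] []; simpl; first [exists [tt]; intros []; left; reflexivity
                             | exists []; intros []].
Qed.

Definition cospanF (C : Category) (x y z : C) (f : hom x z) (g : hom y z) :
  Functor Cospan C.
Proof.
  unshelve refine
    (@Build_Functor Cospan C
       (fun i => match i with Left => x | Right => y | Base => z end) _ _ _).
  - exact (fun i j =>
      match i, j return cospan_hom i j ->
        hom (match i with Left => x | Right => y | Base => z end)
            (match j with Left => x | Right => y | Base => z end) with
      | Left, Left => fun _ => idm x
      | Right, Right => fun _ => idm y
      | Base, Base => fun _ => idm z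
      | Left, Base => fun _ => f
      | Right, Base => fun _ => g
      | _, _ => fun e => match e with end
      end).
  - intros []; reflexivity.
  - intros [] [] [] [] []; simpl; symmetry;
      first [apply comp_id_l | apply comp_id_r].
Defined.

Definition cospan_cone (C : Category) (D : Functor Cospan C) (w : C)
  (a : hom w (D Left)) (b : hom w (D Right))
  (e : fmap D to_base_l ∘ a = fmap D to_base_r ∘ b) : Cone D.
Proof.
  refine (@Build_Cone Cospan C D w
    (fun j => match j return hom w (D j) with
              | Left => a | Right => b | Base => fmap D to_base_l ∘ a end) _).
  intros [] [] [];
    first [ reflexivity | symmetry; exact e
          | etransitivity; [|apply comp_id_l];
            apply (f_equal (fun k => k ∘ _)); apply (fmap_id D) ].
Defined.

(** Taking an arbitrary diagram [D], rather than [cospanF f g], lets the same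
    equivalence apply to the image of a cospan under a functor. *)
Lemma limit_iff_pullback (C : Category) (D : Functor Cospan C) (c : Cone D) :
  IsLimit c <->
  IsPullback (fmap D to_base_l) (fmap D to_base_r) (leg c Left) (leg c Right).
Proof.
  split.
  - intros hl; split.
    { rewrite !leg_natural; reflexivity. }
    intros w a b e; destruct (hl (cospan_cone e)) as [u [h1 h2]].
    exists u; split; [split; [exact (h1 Left) | exact (h1 Right)]|].
    intros v [hv1 hv2]; apply h2; intros []; [exact hv1 | exact hv2|].
    simpl; rewrite <- (leg_natural c to_base_l), <- comp_assoc, hv1.
    reflexivity.
  - intros [sq hp] d.
    destruct (hp (apex d) (leg d Left) (leg d Right)) as [u [[h1 h2] h3]].
    { rewrite !leg_natural; reflexivity. }
    exists u; split; [|intros v hv; apply h3; split; apply hv].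
    intros []; [exact h1 | exact h2|].
    rewrite <- (leg_natural c to_base_l), <- comp_assoc, h1.
    apply leg_natural.
Qed.

Lemma terminal_exists (C : Category) :
  HasFiniteLimits C -> exists T : C, IsTerminal T.
Proof.
  intros hC; destruct (hC _ (emptyF C) EmptyCat_finite) as [c hc].
  exists (apex c); apply limit_iff_terminal; exact hc.
Qed.

Lemma pullback_exists (C : Category) : HasFiniteLimits C ->
  forall (x y z : C) (f : hom x z) (g : hom y z),
  exists (p : C) (p1 : hom p x) (p2 : hom p y), IsPullback f g p1 p2.
Proof.
  intros hC x y z f g.
  destruct (hC _ (cospanF f g) Cospan_finite) as [c hc].
  exists (apex c), (leg c Left), (leg c Right).
  apply limit_iff_pullback in hc; exact hc.
Qed.

Section PreservesLimits.
Context (A B : Category) (G : Functor A B) (hG : PreservesFiniteLimits G).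

Lemma preserves_terminal (T : A) : IsTerminal T -> IsTerminal (G T).
Proof.
  intros hT.
  unshelve epose (c := @Build_Cone EmptyCat A (emptyF A) T
                         (fun j : Empty_set => match j with end) _).
  { intros []. }
  assert (hc : IsLimit c) by (apply limit_iff_terminal; exact hT).
  apply (hG EmptyCat_finite), limit_iff_terminal in hc; exact hc.
Qed.

Lemma preserves_pullback (x y z p : A)
  (f : hom x z) (g : hom y z) (p1 : hom p x) (p2 : hom p y) :
  IsPullback f g p1 p2 ->
  IsPullback (fmap G f) (fmap G g) (fmap G p1) (fmap G p2).
Proof.
  intros hp; pose (c := @cospan_cone A (cospanF f g) p p1 p2 (proj1 hp)).
  assert (hc : IsLimit c) by (apply limit_iff_pullback; exact hp).
  apply (hG Cospan_finite), limit_iff_pullback in hc; exact hc.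
Qed.

End PreservesLimits.

(** * Limits and isomorphisms of sets *)

Lemma SetCat_terminal_element (S : SetCat) : IsTerminal S -> inhabited S.
Proof. intros hS; destruct (hS unit) as [u _]; exact (inhabits (u tt)). Qed.

Lemma SetCat_terminal_singleton (S : SetCat) :
  IsTerminal S -> forall s t : S, s = t.
Proof.
  intros hS s t.
  exact (f_equal (fun k => k tt)
    (@terminal_unique _ _ hS unit (fun _ => s) (fun _ => t))).
Qed.

Lemma SetCat_pullback_element (X Y Z P : SetCat) (f : hom X Z) (g : hom Y Z)
  (p1 : hom P X) (p2 : hom P Y) : IsPullback f g p1 p2 ->
  forall x y, f x = g y -> exists! w, p1 w = x /\ p2 w = y.
Proof.
  intros [_ hp] x y e.
  destruct (hp unit (fun _ => x) (fun _ => y)) as [u [[h1 h2] h3]].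
  { exact (f_equal (fun z (_ : unit) => z) e). }
  exists (u tt); split.
  - split; [exact (f_equal (fun k => k tt) h1)
           | exact (f_equal (fun k => k tt) h2)].
  - intros w [hw1 hw2].
    refine (f_equal (fun k => k tt) (h3 (fun _ => w) (conj _ _))).
    + exact (f_equal (fun v (_ : unit) => v) hw1).
    + exact (f_equal (fun v (_ : unit) => v) hw2).
Qed.

Lemma SetCat_iso_of_bijective (X Y : SetCat) (f : hom X Y) :
  Injective f -> Surjective f -> IsIso f.
Proof.
  intros inj sur.
  pose (g := fun y => proj1_sig (constructive_indefinite_description _ (sur y))).
  assert (hg : forall y, f (g y) = y).
  { intros y; unfold g; apply proj2_sig. }
  exists g; split; apply functional_extensionality; intros x;
    [apply inj|]; apply hg.
Qed.

Lemma fmap_square (C : Category) (U : Functor C SetCat) (w x y z : C)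
  (f : hom x z) (g : hom w x) (f' : hom y z) (g' : hom w y) :
  f ∘ g = f' ∘ g' ->
  forall s, fmap U f (fmap U g s) = fmap U f' (fmap U g' s).
Proof.
  intros e s.
  change ((fmap U f ∘ fmap U g) s = (fmap U f' ∘ fmap U g') s).
  rewrite <- !fmap_comp, e; reflexivity.
Qed.

(** * Full reflective subcategories *)

Section Reflection.
Context (C : Category) (inM : C -> Prop)
  (I : Functor C (FullSubcategory inM)) (adj : Adjunction I (inclusion inM)).

(** [HI], [hi] and [eta] retype the reflection inside [C], where morphisms of
    the full subcategory compose with arbitrary ones. *)
Definition HI (X : C) : C := proj1_sig (I X).
Definition hi (X Y : C) (f : hom X Y) : hom (HI X) (HI Y) := fmap I f.
Definition eta (X : C) : hom X (HI X) := adj_unit adj X.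

Lemma eta_natural (X Y : C) (f : hom X Y) : eta Y ∘ f = hi f ∘ eta X.
Proof. exact (naturality (adj_unit adj) f). Qed.

(** Only uniqueness of factorizations: a unit need not be an epimorphism of
    [C]. *)
Lemma eta_cancel (X N : C) (hN : inM N) (u v : hom (HI X) N) :
  u ∘ eta X = v ∘ eta X -> u = v.
Proof.
  pose (N' := exist inM N hN : FullSubcategory inM).
  assert (key : forall k : @hom (FullSubcategory inM) (I X) N',
    k = adj_counit adj N' ∘ fmap I ((k : hom (HI X) N) ∘ eta X)).
  { intros k; rewrite fmap_comp, comp_assoc.
    etransitivity; [symmetry; apply comp_id_r|].
    rewrite <- (triangle_l adj X), comp_assoc.
    apply (f_equal (fun l => l ∘ _)).
    symmetry; exact (naturality (adj_counit adj) k). }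
  intros e; rewrite (key u), (key v), e; reflexivity.
Qed.

Lemma eta_factor (X N : C) (hN : inM N) (f : hom X N) :
  exists f' : hom (HI X) N, f' ∘ eta X = f.
Proof.
  pose (N' := exist inM N hN : FullSubcategory inM).
  exists ((adj_counit adj N' : hom (HI N) N) ∘ hi f).
  rewrite <- comp_assoc, <- eta_natural, comp_assoc.
  etransitivity; [|apply comp_id_l]; apply (f_equal (fun l => l ∘ f)).
  exact (triangle_r adj N').
Qed.

Lemma eta_iso_of_retraction (X : C) (s : hom (HI X) X) :
  s ∘ eta X = idm X -> IsIso (eta X).
Proof.
  intros hs; exists s; split; [exact hs|].
  apply (eta_cancel (proj2_sig (I X))).
  rewrite <- comp_assoc, hs, comp_id_l; apply comp_id_r.
Qed.

Lemma hi_eta_iso (X : C) : IsIso (hi (eta X)).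
Proof.
  replace (hi (eta X)) with (eta (HI X)).
  - destruct (eta_factor (proj2_sig (I X)) (idm (HI X))) as [s hs].
    exact (eta_iso_of_retraction hs).
  - apply (eta_cancel (proj2_sig (I (HI X)))); apply eta_natural.
Qed.

Lemma HI_terminal (T : C) : IsTerminal T -> IsTerminal (HI T).
Proof.
  intros hT; destruct (hT (HI T)) as [s _].
  assert (e : s ∘ eta T = idm T) by apply (terminal_unique hT).
  destruct (eta_iso_of_retraction e) as [s' [h1 h2]].
  apply (@terminal_of_iso _ _ _ s'); [|exact hT].
  exists (eta T); split; assumption.
Qed.

(** The reflected square has the invertible morphism [I η] as a side, so
    the pullback condition in the subcategory collapses to invertibility of the
    opposite side. *)
Lemma stable_units_iff_iso :
  HasStableUnits adj <->
  forall (X Y : C) (g : hom Y (HI X)) (P : C) (p1 : hom P X) (p2 : hom P Y),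
  IsPullback (eta X) g p1 p2 -> IsIso (hi p2).
Proof.
  assert (key : forall X Y (g : hom Y (HI X)) P (p1 : hom P X) (p2 : hom P Y),
    IsPullback (eta X) g p1 p2 ->
    (IsPullback (fmap I (eta X)) (fmap I g) (fmap I p1) (fmap I p2)
     <-> IsIso (hi p2))).
  { intros X Y g P p1 p2 [sq _].
    apply (@pullback_iff_iso (FullSubcategory inM)); [exact (hi_eta_iso X)|].
    rewrite <- !fmap_comp; exact (f_equal (fmap I) sq). }
  split.
  - intros h X Y g P p1 p2 hp; apply (key _ _ _ _ _ _ hp), h, hp.
  - intros h X Y g P p1 p2 hp.
    exact (proj2 (key _ _ _ _ _ _ hp) (h _ _ _ _ _ _ hp)).
Qed.

(** * The product condition *)

Definition connected_products : Prop :=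
  forall T : C, IsTerminal T ->
  forall (X Y : C) (mu : hom T (HI X)) (nu : hom T (HI Y))
    (Xmu : ConnectedComponent adj mu) (Ynu : ConnectedComponent adj nu)
    (P : C) (p1 : hom P Xmu) (p2 : hom P Ynu),
  IsProduct p1 p2 -> Isomorphic (HI P) T.

Lemma connected_products_of_stable_units :
  HasStableUnits adj -> connected_products.
Proof.
  intros hs T hT X Y mu nu Xmu Ynu P p1 p2 hP.
  pose proof (proj1 stable_units_iff_iso hs) as hiso.
  pose proof (terminal_of_iso (hiso _ _ _ _ _ _ (cc_pullback Xmu))
                (HI_terminal hT)) as hTX.
  pose proof (terminal_of_iso (hiso _ _ _ _ _ _ (cc_pullback Ynu))
                (HI_terminal hT)) as hTY.
  destruct (hTX Ynu) as [g _].
  apply terminal_isomorphic; [|exact hT].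
  apply (@terminal_of_iso _ _ _ (hi p2)); [|exact hTY].
  apply (hiso _ _ g _ p1), (product_iff_pullback hTX); exact hP.
Qed.

Context (U : Functor C SetCat) (hC : HasFiniteLimits C)
  (ha : PreservesFiniteLimits U)
  (hc : forall X : C, Surjective (fmap U (eta X))).

Lemma surjective_hi_pullback (X Y : C) (g : hom Y (HI X)) (P : C)
  (p1 : hom P X) (p2 : hom P Y) :
  IsPullback (eta X) g p1 p2 -> Surjective (fmap U (hi p2)).
Proof.
  intros hP c; destruct (hc c) as [y <-], (hc (fmap U g y)) as [x hx].
  destruct (SetCat_pullback_element (preserves_pullback ha hP) hx)
    as [w [[_ hw] _]].
  exists (fmap U (eta P) w).
  rewrite <- hw; symmetry; apply fmap_square, eta_natural.
Qed.

(** The heart of the converse: the fibre of [U (HI p2)] over the element named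
    by [nu] is covered by the image under [U] of the reflection of a product of
    two connected components. *)
Lemma injective_hi_pullback
  (hd : forall X T : C, IsTerminal T ->
    Surjective (fun f : hom T (HI X) => fmap U f))
  (hprod : connected_products)
  (X Y : C) (g : hom Y (HI X)) (P : C) (p1 : hom P X) (p2 : hom P Y) :
  IsPullback (eta X) g p1 p2 -> Injective (fmap U (hi p2)).
Proof.
  intros hP a b hab.
  destruct (terminal_exists hC) as [T hT].
  pose proof (preserves_terminal ha hT) as hUT.
  destruct (SetCat_terminal_element hUT) as [pt].
  destruct (eta_factor (proj2_sig (I X)) g) as [g' hg'].
  destruct (hd Y T hT (fun _ => fmap U (hi p2) a)) as [nu hnu].
  (* With this [mu] the two components agree over [HI X], and every element of
     [U P] lying over the value of [nu] also lies over the value of [mu]. *)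
  pose (mu := g' ∘ nu).
  destruct (pullback_exists hC (eta X) mu) as [Xmu [i [t hX]]].
  destruct (pullback_exists hC (eta Y) nu) as [Ynu [j [t' hY]]].
  destruct (pullback_exists hC t t') as [Q [q1 [q2 hQ]]].
  destruct (hprod T hT X Y mu nu
              (@Build_ConnectedComponent _ _ _ _ adj _ _ _ _ _ _ hX)
              (@Build_ConnectedComponent _ _ _ _ adj _ _ _ _ _ _ hY)
              Q q1 q2 (proj2 (product_iff_pullback hT t t' q1 q2) hQ))
    as [k hk].
  pose proof (terminal_of_iso hk hT) as hHIQ.
  assert (sq : eta X ∘ (i ∘ q1) = g ∘ (j ∘ q2)).
  { rewrite !comp_assoc, (proj1 hX), <- hg', <- (comp_assoc g'), (proj1 hY).
    unfold mu; rewrite <- !comp_assoc, (proj1 hQ); reflexivity. }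
  destruct (proj2 hP _ _ _ sq) as [h [[hh1 hh2] _]].
  assert (cover : forall a', fmap U (hi p2) a' = fmap U (hi p2) a ->
    exists q, fmap U (hi h) q = a').
  { intros a' ha'; destruct (hc a') as [w <-].
    assert (hy : fmap U (eta Y) (fmap U p2 w) = fmap U nu pt).
    { rewrite (fmap_square (eta_natural p2) w).
      etransitivity; [exact ha'|]; rewrite hnu; reflexivity. }
    assert (hx : fmap U (eta X) (fmap U p1 w) = fmap U mu pt).
    { unfold mu; rewrite fmap_comp.
      change (fmap U (eta X) (fmap U p1 w) = fmap U g' (fmap U nu pt)).
      rewrite <- hy, (fmap_square (proj1 hP) w), <- hg', fmap_comp.
      reflexivity. }
    destruct (SetCat_pullback_element (preserves_pullback ha hX) hx)
      as [x [[hx1 _] _]].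
    destruct (SetCat_pullback_element (preserves_pullback ha hY) hy)
      as [y [[hy1 _] _]].
    destruct (@SetCat_pullback_element _ _ _ _ _ _ _ _
                (preserves_pullback ha hQ) x y
                (SetCat_terminal_singleton hUT _ _)) as [q [[hq1 hq2] _]].
    exists (fmap U (eta Q) q).
    rewrite <- (fmap_square (eta_natural h) q); f_equal.
    (* An element of [U P] is determined by its two projections. *)
    destruct (SetCat_pullback_element (preserves_pullback ha hP)
                (fmap_square (U := U) (proj1 hP) w)) as [w' [_ hw']].
    transitivity w'; [symmetry|]; apply hw'; split; try reflexivity.
    - rewrite (fmap_square hh1), hq1; exact hx1.
    - rewrite (fmap_square hh2), hq2; exact hy1. }
  destruct (cover a eq_refl) as [qa <-], (cover b (eq_sym hab)) as [qb <-].
  f_equal; exact (SetCat_terminal_singleton (preserves_terminal ha hHIQ) qa qb).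
Qed.

End Reflection.

Theorem theorem5p1
  (C : Category) (inM : C -> Prop)
  (I : Functor C (FullSubcategory inM))
  (adj : Adjunction I (inclusion inM))
  (U : Functor C SetCat)
  (hC : HasFiniteLimits C)
  (ha : PreservesFiniteLimits U)
  (hb : ReflectsIsos (compF U (inclusion inM)))
  (hc : forall X : C, Surjective (fmap U (adj_unit adj X)))
  (hd : forall (N : FullSubcategory inM) (T : C), IsTerminal T ->
    Surjective (fun f : hom T (inclusion inM N) => fmap U f)) :
  HasStableUnits adj <->
  (forall T : C, IsTerminal T ->
   forall (X Y : C)
     (mu : hom T (inclusion inM (I X))) (nu : hom T (inclusion inM (I Y)))
     (Xmu : ConnectedComponent adj mu) (Ynu : ConnectedComponent adj nu)
     (P : C) (p1 : hom P Xmu) (p2 : hom P Ynu),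
   IsProduct p1 p2 ->
   Isomorphic (inclusion inM (I P)) T).
Proof.
  split.
  - exact (@connected_products_of_stable_units C inM I adj).
  - intros hprod; apply stable_units_iff_iso; intros X Y g P p1 p2 hP.
    apply (hb (I P) (I Y)), SetCat_iso_of_bijective.
    + exact (injective_hi_pullback hC ha hc (fun Z => hd (I Z)) hprod hP).
    + exact (surjective_hi_pullback ha hc hP).
Qed.
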